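(* Let $(M,h)$ be a Riemannian surface of revolution whose warp function $m$ is bounded, $m(r)<\frac1\mu$ for all $r\ge 0$, with $\mu>0$ a constant; let $W=\mu\frac{\partial}{\partial\theta}$ and let $(M,F=\alpha+\beta)$ be the rotational Randers metric constructed from the navigation data $(h,W)$. Then the $F$-unit speed geodesics $\mathcal P:(-\epsilon,\epsilon)\to M$ of $(M,F)$ are given by $$\mathcal P(s)=(r(s),\theta(s)+\mu s),$$ where $\gamma(s)=(r(s),\theta(s))$ is an $h$-unit speed geodesic of $(M,h)$.
   Context: A Riemannian surface of revolution $(M,h)$ with vertex $p$ is a complete Riemannian manifold homeomorphic to $\mathbb R^2$ whose metric, in $h$-geodesic polar coordinates $(r,\theta)\in[0,\infty)\times(0,2\pi]$ around $p$ ($\theta$ taken mod $2\pi$), is $h=dr^2+m^2(r)\,d\theta^2$, where the warp function $m:[0,\infty)\to[0,\infty)$ is a smooth odd function (i.e. extends to a smooth odd function on $\mathbb R$) with $m(0)=0$, $m'(0)=1$ (and $m(r)>0$ for $r>0$). The vector field $W=\mu\frac{\partial}{\partial\theta}$ vanishes at $p$ and its flow is $(r,\theta)\mapsto(r,\theta+\mu s)$, fixing $p$; the notation $(r(s),\theta(s)+\mu s)$ means the image of $\gamma(s)$ under the time-$s$ flow of $W$. The rotational Randers metric with navigation data $(h,W)$ is $$F(x,y)=\alpha(x,y)+\beta(x,y)=\frac{\sqrt{\lambda\,h(y,y)+h(W,y)^2}}{\lambda}-\frac{h(W,y)}{\lambda},\qquad \lambda=1-h(W,W)=1-\mu^2m^2(r)>0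 .$$ Geodesics of $F$ are geodesics in the usual sense of Finsler geometry (for the non-reversible metric $F$). *)

(* Defs.v *)
From Stdlib Require Import Reals Lra.
From Coquelicot Require Import Coquelicot.
Open Scope R_scope.

(** A surface of revolution with vertex [p] is modelled on [R * R] by the
    Cartesian coordinates [x = (r cos theta, r sin theta)] attached to its
    geodesic polar coordinates around [p], i.e. by the chart [exp_p^-1], which
    is global; the vertex is [(0, 0)].  The tangent space at every point is
    [R * R] in the same coordinates.  Completeness is automatic: [r] runs over
    the whole of [[0, oo)], so closed metric balls around [p] are compact. *)
Definition R2 : Type := (R * R)%type.

Definition polar (r theta : R) : R2 := (r * cos theta, r * sin theta).

Definition rad (x : R2) : R := sqrt (fst x ^ 2 + snd x ^ 2).

(** [m] is the odd extension to [R] of the warp function on [[0, oo)]. *)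
Record warp_function (m : R -> R) : Prop := {
  warp_smooth : forall (n : nat) (r : R), ex_derive_n m n r;
  warp_odd : forall r : R, m (- r) = - m r;
  warp_0 : m 0 = 0;
  warp_slope : Derive m 0 = 1;
  warp_pos : forall r : R, 0 < r -> 0 < m r }.

(** The 1-forms [dr] and [dtheta] in Cartesian coordinates, for [x <> (0, 0)]. *)
Definition dr (x v : R2) : R := (fst x * fst v + snd x * snd v) / rad x.

Definition dtheta (x v : R2) : R :=
  (fst x * snd v - snd x * fst v) / rad x ^ 2.

(** [h = dr^2 + m(r)^2 dtheta^2], extended to the vertex by the Euclidean inner
    product, its continuous extension since [m r ~ r] at [0]. *)
Definition revolution_metric (m : R -> R) (x v w : R2) : R :=
  if Req_EM_T (rad x) 0 then fst v * fst w + snd v * snd w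
  else dr x v * dr x w + m (rad x) ^ 2 * (dtheta x v * dtheta x w).

(** [mu d/dtheta] *)
Definition rotation_field (mu : R) (x : R2) : R2 :=
  (- (mu * snd x), mu * fst x).

Definition rotation_flow (mu s : R) (x : R2) : R2 :=
  (cos (mu * s) * fst x - sin (mu * s) * snd x,
   sin (mu * s) * fst x + cos (mu * s) * snd x).

Definition riemannian_norm (h : R2 -> R2 -> R2 -> R) (x y : R2) : R :=
  sqrt (h x y y).

Section Randers.
Variables (h : R2 -> R2 -> R2 -> R) (W : R2 -> R2).

Definition randers_lambda (x : R2) : R := 1 - h x (W x) (W x).

Definition randers_alpha (x y : R2) : R :=
  sqrt (randers_lambda x * h x y y + h x (W x) y ^ 2) / randers_lambda x.

Definition randers_beta (x y : R2) : R := - (h x (W x) y / randers_lambda x).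

Definition randers (x y : R2) : R := randers_alpha x y + randers_beta x y.
End Randers.

Section Geodesics.

Definition velocity (c : R -> R2) (t : R) : R2 :=
  (Derive (fun s => fst (c s)) t, Derive (fun s => snd (c s)) t).

Definition smooth_curve (eps : R) (c : R -> R2) : Prop :=
  forall (n : nat) (t : R), - eps < t < eps ->
    ex_derive_n (fun s => fst (c s)) n t /\
    ex_derive_n (fun s => snd (c s)) n t.

Variable L : R2 -> R2 -> R.

Definition partial_x1 (x y : R2) : R := Derive (fun u => L (u, snd x) y) (fst x).
Definition partial_x2 (x y : R2) : R := Derive (fun u => L (fst x, u) y) (snd x).
Definition partial_y1 (x y : R2) : R := Derive (fun u => L x (u, snd y)) (fst y).
Definition partial_y2 (x y : R2) : R := Derive (fun u => L x (fst y, u)) (snd y).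

(** [d/dt (dL/dy^i (c, c')) = dL/dx^i (c, c')] on [(-eps, eps)]. *)
Definition euler_lagrange (eps : R) (c : R -> R2) : Prop :=
  forall t : R, - eps < t < eps ->
    is_derive (fun s => partial_y1 (c s) (velocity c s)) t
      (partial_x1 (c t) (velocity c t)) /\
    is_derive (fun s => partial_y2 (c s) (velocity c s)) t
      (partial_x2 (c t) (velocity c t)).
End Geodesics.

(** Geodesics of the (possibly non-reversible) Finsler metric [F]: the smooth
    solutions of the Euler-Lagrange equations of the energy [F^2 / 2].  Where
    the fundamental tensor of [F] is nondegenerate this reads
    [c'' + 2 G(c, c') = 0] with [G] the spray coefficients of [F]; for
    [F = riemannian_norm h] it is the geodesic equation of the Levi-Civita
    connection of [h]. *)
Definition geodesic (F : R2 -> R2 -> R) (eps : R) (c : R -> R2) : Prop :=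
  smooth_curve eps c /\ euler_lagrange (fun x y => F x y ^ 2 / 2) eps c.

Definition unit_speed_geodesic (F : R2 -> R2 -> R) (eps : R) (c : R -> R2) :
    Prop :=
  geodesic F eps c /\
  forall t : R, - eps < t < eps -> F (c t) (velocity c t) = 1.

Lemma rad_polar (r theta : R) : 0 <= r -> rad (polar r theta) = r.
Proof.
intros Hr. unfold rad, polar; simpl.
replace (_ + _) with (r * r * (Rsqr (sin theta) + Rsqr (cos theta)))
  by (unfold Rsqr; ring).
rewrite sin2_cos2, Rmult_1_r. now apply sqrt_square.
Qed.

(** [h (a d/dr + b d/dtheta, a' d/dr + b' d/dtheta) = a a' + m(r)^2 b b']. *)
Lemma revolution_metric_polar (m : R -> R) (r theta a b a' b' : R) :
  0 < r ->
  revolution_metric m (polar r theta)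
    (a * cos theta - b * (r * sin theta), a * sin theta + b * (r * cos theta))
    (a' * cos theta - b' * (r * sin theta),
     a' * sin theta + b' * (r * cos theta))
  = a * a' + m r ^ 2 * (b * b').
Proof.
intros Hr. unfold revolution_metric, dr, dtheta.
rewrite rad_polar by lra.
destruct (Req_EM_T r 0) as [H0 | H0]; [lra |].
assert (Hdr : forall u v, (fst (polar r theta) * (u * cos theta - v * (r * sin theta)) + snd (polar r theta) * (u * sin theta + v * (r * cos theta))) / r = u).
{ intros u v. unfold polar; simpl.
  replace (_ + _) with (r * u * (Rsqr (sin theta) + Rsqr (cos theta)))
    by (unfold Rsqr; ring).
  rewrite sin2_cos2. now field. }
assert (Hdt : forall u v, (fst (polar r theta) * (u * sin theta + v * (r * cos theta)) - snd (polar r theta) * (u * cos theta - v * (r * sin theta))) / r ^ 2 = v).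
{ intros u v. unfold polar, fst, snd.
  replace (_ - _) with (r ^ 2 * v * (Rsqr (sin theta) + Rsqr (cos theta)))
    by (unfold Rsqr; ring).
  rewrite sin2_cos2. now field. }
cbn [fst snd] in *. now rewrite !Hdr, !Hdt.
Qed.

Lemma rotation_flow_polar (mu s r theta : R) :
  rotation_flow mu s (polar r theta) = polar r (theta + mu * s).
Proof.
unfold rotation_flow, polar; simpl.
rewrite cos_plus, sin_plus. f_equal; ring.
Qed.

Lemma rotation_flow_0 (mu : R) (x : R2) : rotation_flow mu 0 x = x.
Proof.
destruct x as [x1 x2]. unfold rotation_flow; simpl.
rewrite Rmult_0_r, cos_0, sin_0. f_equal; ring.
Qed.

Lemma velocity_rotation_flow (mu s : R) (x : R2) :
  velocity (fun t => rotation_flow mu t x) s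
  = rotation_field mu (rotation_flow mu s x).
Proof.
unfold velocity, rotation_flow, rotation_field; simpl.
f_equal; apply is_derive_unique; auto_derive; trivial; ring.
Qed.

(* Main.v *)
Require Import Defs.
From Stdlib Require Import Reals Lra.
From Coquelicot Require Import Coquelicot.
Open Scope R_scope.

(** Along a curve [P] put [v = P' - W(P)], the velocity relative to the wind.
    Zermelo navigation says that [F(x, y) = 1] exactly when
    [h(y - W, y - W) = 1].  If [P = phi_s(gamma)] with [phi] the flow of [W],
    then [v] is the image of [gamma'] under [d phi_s], and [phi_s] is an isometry
    of [h]; hence [P] has [F]-unit speed iff [gamma] has [h]-unit speed
    ([randers_unit_iff], [air_velocity_rotation], [metric_rotation]).

    It remains to compare the Euler-Lagrange equations.  [F] is determined by
    [h(y - F W, y - F W) = F^2], and differentiating this relation where [F = 1]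
    gives, with the drift factor [D = 1 + h(W, v)],
    [d(F^2/2) (x', y') = (1/2 (d_x h)(x') (v, v) + h(v, y' - dW(x'))) / D]
    ([is_derive_randers_energy]).  So the [F]-momentum is [h(v, .) / D], which
    the rotation carries back to [p / D], where [p = h(gamma', .)] is the
    [h]-momentum; the term [- h(v, dW)] is what the time dependence of the
    rotation contributes.  In the rotating frame the Euler-Lagrange equations
    therefore read [(p / D)' = f / D] for [F] and [p' = f] for [h], with the same
    force [f].

    Both systems make [D = 1 + mu (gamma x p)] stationary: rotational symmetry of
    [h] is the infinitesimal identity [gamma' x p + gamma x f = 0]
    ([clairaut_balance]), which says that [gamma x p] is conserved in the second
    system (Clairaut's relation) and that [gamma x (p / D)] is conserved in the
    first, where [mu (gamma x (p / D)) = 1 - 1 / D].  As [D > 0] by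
    Cauchy-Schwarz and [h(W, W) < 1], the two systems are equivalent
    ([rotated_momentum_balance]).

    The vertex needs no separate treatment of the dynamics: writing
    [h = v . w + G(|x|^2) (x x v) (x x w)] ([revolution_metric_warp_defect]), the
    correction vanishes to second order at the vertex because [G] is bounded
    there ([warp_defect_bounded]), and this yields all first derivatives used. *)

(** * Calculus on an interval *)

Lemma is_derive_eq (f : R -> R) (t a b : R) :
  is_derive f t a -> a = b -> is_derive f t b.
Proof. now intros H <-. Qed.

Lemma is_derive_Rplus (f g : R -> R) (t f' g' : R) :
  is_derive f t f' -> is_derive g t g' ->
  is_derive (fun u => f u + g u) t (f' + g').
Proof. intros Hf Hg. exact (is_derive_plus f g t f' g' Hf Hg). Qed.

Lemma is_derive_Rminus (f g : R -> R) (t f' g' : R) :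
  is_derive f t f' -> is_derive g t g' ->
  is_derive (fun u => f u - g u) t (f' - g').
Proof. intros Hf Hg. exact (is_derive_minus f g t f' g' Hf Hg). Qed.

Lemma is_derive_Rmult (f g : R -> R) (t f' g' : R) :
  is_derive f t f' -> is_derive g t g' ->
  is_derive (fun u => f u * g u) t (f' * g t + f t * g').
Proof. intros Hf Hg. exact (is_derive_mult f g t f' g' Hf Hg Rmult_comm). Qed.

Lemma is_derive_Rdiv (f g : R -> R) (t f' g' : R) :
  is_derive f t f' -> is_derive g t g' -> g t <> 0 ->
  is_derive (fun u => f u / g u) t ((f' * g t - f t * g') / g t ^ 2).
Proof. intros Hf Hg Hg0. exact (is_derive_div f g t f' g' Hf Hg Hg0). Qed.

Lemma is_derive_affine (a b : R) (f : R -> R) (t f' : R) :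
  is_derive f t f' -> is_derive (fun u => a + b * f u) t (b * f').
Proof.
intros Hf. eapply is_derive_eq.
- apply (is_derive_Rplus (fun _ => a) (fun u => b * f u) t 0 (b * f')).
  + exact (is_derive_const a t).
  + exact (is_derive_scal f t b f' Hf).
- ring.
Qed.

Lemma is_derive_cos_scal (mu t : R) :
  is_derive (fun s => cos (mu * s)) t (- (mu * sin (mu * t))).
Proof. auto_derive; trivial; ring. Qed.

Lemma is_derive_sin_scal (mu t : R) :
  is_derive (fun s => sin (mu * s)) t (mu * cos (mu * t)).
Proof. auto_derive; trivial; ring. Qed.

Lemma continuous_locally_close (f : R -> R) (t e : R) :
  continuous f t -> 0 < e -> locally t (fun u => Rabs (f u - f t) < e).
Proof.
intros Hc He.
exact (Hc _ (locally_ball (f t) (mkposreal e He))).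
Qed.

(** A product of two functions vanishing at [t] is of second order there, so a
    merely bounded factor does not spoil its differentiability.  This is how
    derivatives across the vertex are taken. *)
Lemma is_derive_bounded_mult (g a b : R -> R) (t C a' b' : R) :
  locally t (fun u => Rabs (g u) <= C) ->
  a t = 0 -> is_derive a t a' -> b t = 0 -> is_derive b t b' ->
  is_derive (fun u => g u * (a u * b u)) t 0.
Proof.
intros [d1 Hg] Ha0 Ha Hb0 Hb. apply is_derive_Reals. intros e He.
assert (HC : 0 <= C).
{ apply Rle_trans with (1 := Rabs_pos (g t)), Hg, ball_center. }
pose proof (Rabs_pos a') as Ha'.
assert (He' : 0 < e / ((C + 1) * (Rabs a' + 1)))
  by (apply Rdiv_lt_0_compat; nra).
apply is_derive_Reals in Ha. destruct (Ha 1 Rlt_0_1) as [d2 Hq].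
assert (Hbc : continuous b t)
  by exact (ex_derive_continuous b t (ex_intro _ b' Hb)).
destruct (continuous_locally_close _ _ _ Hbc He') as [d3 Hk].
assert (Hd : 0 < Rmin d1 (Rmin d2 d3))
  by (repeat apply Rmin_glb_lt; apply cond_pos).
exists (mkposreal _ Hd). intros k Hk0 Hkd; simpl in Hkd.
assert (E1 : Rabs k < d1) by (eapply Rlt_le_trans; [exact Hkd | apply Rmin_l]).
assert (Hkd' : Rabs k < Rmin d2 d3)
  by (eapply Rlt_le_trans; [exact Hkd | apply Rmin_r]).
assert (E2 : Rabs k < d2) by (eapply Rlt_le_trans; [exact Hkd' | apply Rmin_l]).
assert (E3 : Rabs k < d3) by (eapply Rlt_le_trans; [exact Hkd' | apply Rmin_r]).
assert (Hball : forall d : posreal, Rabs k < d -> ball t d (t + k)).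
{ intros d Hlt. change (Rabs (t + k - t) < d).
  now replace (t + k - t) with k by ring. }
specialize (Hg _ (Hball _ E1)). specialize (Hk _ (Hball _ E3)).
specialize (Hq k Hk0 E2).
rewrite Hb0, Rminus_0_r in Hk. rewrite Ha0, Rminus_0_r in Hq.
(* The difference quotient is bounded * bounded * (a term tending to 0). *)
replace (_ - 0) with (g (t + k) * (a (t + k) / k) * b (t + k))
  by (rewrite Ha0; now field).
rewrite !Rabs_mult.
assert (Hq' : Rabs (a (t + k) / k) <= Rabs a' + 1).
{ replace (a (t + k) / k) with (a' + (a (t + k) / k - a')) by ring.
  eapply Rle_trans; [apply Rabs_triang | lra]. }
apply Rle_lt_trans with (C * (Rabs a' + 1) * Rabs (b (t + k))).
{ apply Rmult_le_compat_r; [apply Rabs_pos |].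
  apply Rmult_le_compat; trivial; apply Rabs_pos. }
apply Rle_lt_trans with ((C + 1) * (Rabs a' + 1) * Rabs (b (t + k))).
{ apply Rmult_le_compat_r; [apply Rabs_pos | nra]. }
replace e with ((C + 1) * (Rabs a' + 1) * (e / ((C + 1) * (Rabs a' + 1))))
  by (field; lra).
apply Rmult_lt_compat_l; nra.
Qed.

Lemma locally_interval (eps t : R) (Q : R -> Prop) :
  - eps < t < eps -> (forall s, - eps < s < eps -> Q s) -> locally t Q.
Proof.
intros Ht HQ.
assert (Hd : 0 < Rmin (t + eps) (eps - t)) by (apply Rmin_glb_lt; lra).
exists (mkposreal _ Hd). intros s Hs. apply HQ.
change (Rabs (s - t) < Rmin (t + eps) (eps - t)) in Hs.
pose proof (Rmin_l (t + eps) (eps - t)). pose proof (Rmin_r (t + eps) (eps - t)).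
apply Rabs_def2 in Hs. lra.
Qed.

Lemma is_derive_interval_iff (eps : R) (f g : R -> R) (t a b : R) :
  - eps < t < eps -> (forall s, - eps < s < eps -> f s = g s) -> a = b ->
  is_derive f t a <-> is_derive g t b.
Proof.
intros Ht Hfg <-. split; apply is_derive_ext_loc;
  apply (locally_interval eps); trivial; intros s Hs;
  now rewrite (Hfg s Hs).
Qed.

Lemma forall_interval_iff (eps : R) (A B : R -> Prop) :
  (forall t, - eps < t < eps -> (A t <-> B t)) ->
  (forall t, - eps < t < eps -> A t) <-> (forall t, - eps < t < eps -> B t).
Proof. intros H. split; intros H' t Ht; now apply (H t Ht), H'. Qed.

Lemma and_iff (A B A' B' : Prop) :
  (A <-> A') -> (B <-> B') -> A /\ B <-> A' /\ B'.
Proof. tauto. Qed.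

(** * The metric in Cartesian coordinates *)

Definition dot (v w : R2) : R := fst v * fst w + snd v * snd w.
Definition cross (v w : R2) : R := fst v * snd w - snd v * fst w.
Definition e1 : R2 := (1, 0).
Definition e2 : R2 := (0, 1).

Definition sqr_norm (x : R2) : R := fst x ^ 2 + snd x ^ 2.

(** The coefficient [G] in [h = v . w + G(|x|^2) (x x v) (x x w)]; it measures the
    deviation of [h] from the Euclidean metric, and its limit at [0] is
    [m'''(0) / 3], minus one third of the curvature at the vertex. *)
Definition warp_defect (m : R -> R) (u : R) : R := (m (sqrt u) ^ 2 / u - 1) / u.

Lemma sqr_norm_ge0 (x : R2) : 0 <= sqr_norm x.
Proof. unfold sqr_norm. nra. Qed.

Lemma sqr_norm_eq0 (x : R2) : sqr_norm x = 0 -> fst x = 0 /\ snd x = 0.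
Proof. unfold sqr_norm. intros H. split; nra. Qed.

Lemma rad_sqr (x : R2) : rad x ^ 2 = sqr_norm x.
Proof. apply pow2_sqrt, sqr_norm_ge0. Qed.

(** Off the vertex this is Lagrange's identity
    [(x . v)(x . w) + (x x v)(x x w) = |x|^2 (v . w)]; at the vertex the cross
    products vanish. *)
Lemma revolution_metric_warp_defect (m : R -> R) (x v w : R2) :
  revolution_metric m x v w
  = dot v w + warp_defect m (sqr_norm x) * (cross x v * cross x w).
Proof.
pose proof (rad_sqr x) as Hr.
unfold revolution_metric, dr, dtheta, warp_defect.
change (sqrt (sqr_norm x)) with (rad x).
destruct (Req_EM_T (rad x) 0) as [H0 | H0].
- rewrite H0 in Hr.
  destruct (sqr_norm_eq0 x) as [H1 H2]; [lra |].
  unfold dot, cross. rewrite H1, H2. ring.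
- rewrite <- Hr.
  assert (E : dot v w = ((fst x * fst v + snd x * snd v) *
    (fst x * fst w + snd x * snd w) + cross x v * cross x w) / rad x ^ 2).
  { rewrite Hr. unfold dot, cross, sqr_norm in *. field. rewrite <- Hr.
    now apply pow_nonzero. }
  rewrite E. unfold cross. now field.
Qed.

Lemma revolution_metric_ge0 (m : R -> R) (x v : R2) :
  0 <= revolution_metric m x v v.
Proof.
unfold revolution_metric. destruct (Req_EM_T (rad x) 0); [nra |].
generalize (dr x v) (dtheta x v) (m (rad x)). intros a b c.
replace (_ + _) with (a ^ 2 + (c * b) ^ 2) by ring. nra.
Qed.

Lemma revolution_metric_cauchy_schwarz (m : R -> R) (x v w : R2) :
  revolution_metric m x v w ^ 2
  <= revolution_metric m x v v * revolution_metric m x w w.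
Proof.
unfold revolution_metric. destruct (Req_EM_T (rad x) 0).
- pose proof (pow2_ge_0 (fst v * snd w - snd v * fst w)). nra.
- generalize (dr x v) (dtheta x v) (dr x w) (dtheta x w) (m (rad x)).
  intros a b a' b' c. pose proof (pow2_ge_0 (c * (a * b' - a' * b))). nra.
Qed.

Lemma rotation_field_norm (m : R -> R) (mu : R) (x : R2) (hm0 : m 0 = 0) :
  revolution_metric m x (rotation_field mu x) (rotation_field mu x)
  = (mu * m (rad x)) ^ 2.
Proof.
pose proof (rad_sqr x) as Hr.
unfold revolution_metric, dr, dtheta, rotation_field; simpl fst; simpl snd.
destruct (Req_EM_T (rad x) 0) as [H0 | H0].
- rewrite H0 in *. destruct (sqr_norm_eq0 x) as [H1 H2]; [lra |].
  rewrite H1, H2, hm0. ring.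
- replace ((fst x * - (mu * snd x) + snd x * (mu * fst x)) / rad x) with 0
    by (now field).
  replace ((fst x * (mu * fst x) - snd x * - (mu * snd x)) / rad x ^ 2)
    with mu; [ring |].
  rewrite Hr. unfold sqr_norm in *. field. rewrite <- Hr.
  now apply pow_nonzero.
Qed.

Lemma odd_Derive2_0 (f : R -> R) (hs : forall n r, ex_derive_n f n r)
    (hf : forall r, f (- r) = - f r) :
  Derive_n f 2 0 = 0.
Proof.
assert (H : Derive_n (fun r => f (- r)) 2 0 = Derive_n (fun r => - f r) 2 0)
  by (apply Derive_n_ext; exact hf).
rewrite Derive_n_opp, Derive_n_comp_opp, Ropp_0 in H.
- simpl in *. lra.
- apply filter_forall. intros y k _. apply hs.
Qed.

(** Oddness kills the quadratic Taylor coefficient of [m]. *)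
Lemma warp_cubic (m : R -> R) (hm : warp_function m) :
  exists K d, 0 < d /\ forall r, 0 < r < d ->
    exists k, Rabs k <= K /\ m r = r + k * r ^ 3.
Proof.
destruct hm as [hs ho h0 h1 _].
pose proof (odd_Derive2_0 m hs ho) as h2.
assert (Hc : continuous (Derive_n m 3) 0)
  by exact (ex_derive_continuous (Derive_n m 3) 0 (hs 4%nat 0)).
destruct (continuous_locally_close _ _ _ Hc Rlt_0_1) as [d Hd].
exists (Rabs (Derive_n m 3 0) + 1), d. split; [apply cond_pos |].
intros r Hr.
destruct (Taylor_Lagrange m 2 0 r) as [z [Hz E]]; [lra | intros; apply hs |].
exists (Derive_n m 3 z / 6). split.
- assert (Hb : Rabs (Derive_n m 3 z - Derive_n m 3 0) < 1).
  { apply (Hd z). change (Rabs (z - 0) < d).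
    rewrite Rminus_0_r, Rabs_pos_eq; lra. }
  apply Rabs_def2 in Hb. revert Hb.
  generalize (Derive_n m 3 z) (Derive_n m 3 0). intros a b Hb.
  unfold Rabs. repeat destruct Rcase_abs; lra.
- rewrite E. change (Derive_n m 0 0 = 0) in h0.
  change (Derive_n m 1 0 = 1) in h1. cbn [sum_f_R0].
  rewrite h0, h1, h2. simpl. field.
Qed.

(** With [m r = r + k r^3] one has [G(r^2) = 2 k + k^2 r^2].  The summand
    [|G 0|] of the bound covers the junk value at [u = 0]. *)
Lemma warp_defect_bounded (m : R -> R) (hm : warp_function m) :
  exists C d, 0 < d /\ forall u, 0 <= u < d -> Rabs (warp_defect m u) <= C.
Proof.
destruct (warp_cubic m hm) as [K [d [Hd HK]]].
exists (Rabs (warp_defect m 0) + 2 * K + K ^ 2), (Rmin 1 (d ^ 2)).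
split; [apply Rmin_glb_lt; [lra | now apply pow_lt] |].
intros u [Hu0 Hu1].
assert (Hud : u < d ^ 2) by (eapply Rlt_le_trans; [exact Hu1 | apply Rmin_r]).
assert (Hul : u < 1) by (eapply Rlt_le_trans; [exact Hu1 | apply Rmin_l]).
assert (HK0 : 0 <= K).
{ destruct (HK (d / 2)) as [k [Hk _]]; [lra |].
  pose proof (Rabs_pos k). lra. }
pose proof (Rabs_pos (warp_defect m 0)) as H0.
destruct (Req_dec u 0) as [-> | Hu]; [nra |].
assert (Hs : 0 < sqrt u) by (apply sqrt_lt_R0; lra).
assert (Hsu : sqrt u ^ 2 = u) by now apply pow2_sqrt.
destruct (HK (sqrt u)) as [k [Hk E]]; [split; [assumption | nra] |].
assert (ED : warp_defect m u = 2 * k + k ^ 2 * u).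
{ unfold warp_defect. rewrite E. revert Hsu Hs. generalize (sqrt u).
  intros r Hr Hr0. rewrite <- Hr. field. lra. }
rewrite ED. apply Rabs_le_between in Hk.
assert (k ^ 2 <= K ^ 2) by nra. apply Rabs_le. nra.
Qed.

Lemma ex_derive_warp_defect (m : R -> R) (hm : warp_function m) (u : R) :
  0 < u -> ex_derive (warp_defect m) u.
Proof.
intros Hu. unfold warp_defect.
assert (Hm : ex_derive m (sqrt u)) by exact (warp_smooth m hm 1 _).
auto_derive. repeat split; trivial; lra.
Qed.

(** * Differentiating the metric along curves *)

Definition is_derive2 (c : R -> R2) (t : R) (c' : R2) : Prop :=
  is_derive (fun u => fst (c u)) t (fst c') /\
  is_derive (fun u => snd (c u)) t (snd c').

Lemma is_derive_dot (v w : R -> R2) (t : R) (v' w' : R2) :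
  is_derive2 v t v' -> is_derive2 w t w' ->
  is_derive (fun u => dot (v u) (w u)) t (dot v' (w t) + dot (v t) w').
Proof.
intros [Hv1 Hv2] [Hw1 Hw2]. unfold dot. eapply is_derive_eq.
- apply is_derive_Rplus; apply is_derive_Rmult; eassumption.
- simpl. ring.
Qed.

Lemma is_derive_cross (v w : R -> R2) (t : R) (v' w' : R2) :
  is_derive2 v t v' -> is_derive2 w t w' ->
  is_derive (fun u => cross (v u) (w u)) t (cross v' (w t) + cross (v t) w').
Proof.
intros [Hv1 Hv2] [Hw1 Hw2]. unfold cross. eapply is_derive_eq.
- apply is_derive_Rminus; apply is_derive_Rmult; eassumption.
- simpl. ring.
Qed.

Lemma sqr_norm_dot (x : R2) : sqr_norm x = dot x x.
Proof. unfold sqr_norm, dot. ring. Qed.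

Lemma is_derive_sqr_norm (x : R -> R2) (t : R) (x' : R2) :
  is_derive2 x t x' ->
  is_derive (fun u => sqr_norm (x u)) t (2 * dot (x t) x').
Proof.
intros Hx. apply is_derive_ext with (fun u => dot (x u) (x u)).
- intros u. symmetry. apply sqr_norm_dot.
- eapply is_derive_eq; [now apply is_derive_dot; eassumption |].
  unfold dot. ring.
Qed.

(** Away from the vertex this is the product rule.  At the vertex every
    term of the right-hand side vanishes, so one formula serves all points. *)
Lemma is_derive_warp_defect_mult (m : R -> R) (hm : warp_function m)
    (x : R -> R2) (a b : R -> R) (t : R) (x' : R2) (a' b' : R) :
  is_derive2 x t x' -> is_derive a t a' -> is_derive b t b' ->
  (sqr_norm (x t) = 0 -> a t = 0 /\ b t = 0) ->
  is_derive (fun u => warp_defect m (sqr_norm (x u)) * (a u * b u)) t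
    (2 * dot (x t) x' * Derive (warp_defect m) (sqr_norm (x t)) * (a t * b t)
     + warp_defect m (sqr_norm (x t)) * (a' * b t + a t * b')).
Proof.
intros Hx Ha Hb H0. pose proof (is_derive_sqr_norm x t x' Hx) as HN.
destruct (sqr_norm_ge0 (x t)) as [Hpos | Hz].
- apply (is_derive_Rmult (fun u => warp_defect m (sqr_norm (x u)))
    (fun u => a u * b u)); [| now apply is_derive_Rmult].
  exact (is_derive_comp (warp_defect m) (fun u => sqr_norm (x u)) t _ _
    (Derive_correct _ _ (ex_derive_warp_defect m hm _ Hpos)) HN).
- destruct H0 as [Ha0 Hb0]; [easy |].
  destruct (warp_defect_bounded m hm) as [C [d [Hd HC]]].
  eapply is_derive_eq.
  + apply (is_derive_bounded_mult (fun u => warp_defect m (sqr_norm (x u)))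
      a b t C a' b'); trivial.
    assert (Hc : continuous (fun u => sqr_norm (x u)) t)
      by exact (ex_derive_continuous _ t (ex_intro _ _ HN)).
    destruct (continuous_locally_close _ _ _ Hc Hd) as [d' Hd'].
    exists d'. intros u Hu. apply HC.
    specialize (Hd' u Hu). rewrite <- Hz in Hd'.
    rewrite Rminus_0_r in Hd'. split; [apply sqr_norm_ge0 |].
    eapply Rle_lt_trans; [apply Rle_abs | exact Hd'].
  + rewrite Ha0, Hb0. ring.
Qed.

(** The derivative of [h] in its base point [x] in the direction [e], the vectors
    [v] and [w] being held constant. *)
Definition metric_dx (m : R -> R) (x e v w : R2) : R :=
  2 * dot x e * Derive (warp_defect m) (sqr_norm x) * (cross x v * cross x w)
  + warp_defect m (sqr_norm x)
    * (cross e v * cross x w + cross x v * cross e w).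

Lemma is_derive_metric (m : R -> R) (hm : warp_function m)
    (x v w : R -> R2) (t : R) (x' v' w' : R2) :
  is_derive2 x t x' -> is_derive2 v t v' -> is_derive2 w t w' ->
  is_derive (fun u => revolution_metric m (x u) (v u) (w u)) t
    (revolution_metric m (x t) v' (w t) + revolution_metric m (x t) (v t) w'
     + metric_dx m (x t) x' (v t) (w t)).
Proof.
intros Hx Hv Hw.
apply is_derive_ext with (fun u => dot (v u) (w u)
  + warp_defect m (sqr_norm (x u)) * (cross (x u) (v u) * cross (x u) (w u))).
{ intros u. symmetry. apply revolution_metric_warp_defect. }
eapply is_derive_eq.
- apply is_derive_Rplus; [now apply is_derive_dot; eassumption |].
  apply is_derive_warp_defect_mult;
    [assumption | eassumption | now apply is_derive_cross; eassumption .. |].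
  intros H0. destruct (sqr_norm_eq0 _ H0) as [H1 H2].
  unfold cross. rewrite H1, H2. split; ring.
- rewrite !revolution_metric_warp_defect. unfold metric_dx. simpl. ring.
Qed.

(** * Zermelo navigation *)

Definition air_velocity (mu : R) (x y : R2) : R2 :=
  (fst y + mu * snd x, snd y - mu * fst x).

Section Navigation.
Variables (m : R -> R) (mu : R).
Hypothesis hm : warp_function m.
Hypothesis hmu : 0 < mu.
Hypothesis hbound : forall r : R, 0 <= r -> m r < 1 / mu.

Let h := revolution_metric m.
Let W := rotation_field mu.

(** The denominator [h(W, y) + lambda F(x, y)] that appears on differentiating the
    Randers metric, written in terms of the air velocity [v = y - W] when
    [F(x, y) = 1]. *)
Definition drift_factor (x v : R2) : R :=
  1 + revolution_metric m x (rotation_field mu x) v.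

Lemma randers_lambda_gt0 (x : R2) : 0 < randers_lambda h W x.
Proof.
unfold randers_lambda, h, W. rewrite rotation_field_norm by apply hm.
assert (Hr : 0 <= rad x) by apply sqrt_pos.
assert (Hm0 : 0 <= m (rad x)).
{ destruct Hr as [Hr | <-]; [left; now apply hm | rewrite (warp_0 m hm); lra]. }
assert (Hm1 : mu * m (rad x) < 1).
{ replace 1 with (mu * (1 / mu)) by (field; lra).
  apply Rmult_lt_compat_l; [assumption | now apply hbound]. }
assert (Hmm : 0 <= mu * m (rad x)) by (apply Rmult_le_pos; lra).
nra.
Qed.

(** Cauchy-Schwarz gives [h(W, v)^2 <= h(W, W) < 1]. *)
Lemma drift_factor_gt0 (x v : R2) : h x v v = 1 -> 0 < drift_factor x v.
Proof.
intros Hv. unfold drift_factor.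
pose proof (revolution_metric_cauchy_schwarz m x (rotation_field mu x) v) as HC.
pose proof (randers_lambda_gt0 x) as Hl.
unfold randers_lambda, h, W in *. rewrite Hv, Rmult_1_r in HC.
revert HC Hl. generalize (revolution_metric m x (rotation_field mu x) v).
intros b HC Hl. apply Rnot_le_lt. intros Hb. nra.
Qed.

Lemma metric_air_velocity (x y : R2) :
  h x (air_velocity mu x y) (air_velocity mu x y)
  = h x y y - 2 * h x (W x) y + h x (W x) (W x).
Proof.
unfold h, W, air_velocity, rotation_field.
rewrite !revolution_metric_warp_defect. unfold dot, cross. simpl. ring.
Qed.

Lemma drift_factor_air_velocity (x y : R2) :
  drift_factor x (air_velocity mu x y) = h x (W x) y + randers_lambda h W x.
Proof.
unfold drift_factor, randers_lambda, h, W, air_velocity, rotation_field.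
rewrite !revolution_metric_warp_defect. unfold dot, cross. simpl. ring.
Qed.

(** With [l = lambda], [A = h(y, y)], [B = h(W, y)], both conditions amount to
    [A = l + 2 B], under which the radicand [l A + B^2] is the perfect square
    [(l + B)^2]; extracting its root requires [l + B = D > 0]. *)
Lemma randers_unit_iff (x y : R2) :
  randers h W x y = 1 <->
  h x (air_velocity mu x y) (air_velocity mu x y) = 1.
Proof.
pose proof (randers_lambda_gt0 x) as Hl.
pose proof (revolution_metric_ge0 m x y) as HA.
pose proof (drift_factor_gt0 x (air_velocity mu x y)) as HD.
rewrite drift_factor_air_velocity in HD.
rewrite metric_air_velocity in *. fold h in HA.
unfold randers, randers_alpha, randers_beta.
assert (Hw : h x (W x) (W x) = 1 - randers_lambda h W x)
  by (unfold randers_lambda; ring).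
rewrite Hw in *. revert Hl HA HD.
generalize (randers_lambda h W x) (h x y y) (h x (W x) y).
intros l A B Hl HA HD. split; intros H.
- assert (Hs : sqrt (l * A + B ^ 2) = l + B).
  { replace (sqrt (l * A + B ^ 2))
      with (l * (sqrt (l * A + B ^ 2) / l + - (B / l)) + B)
      by (field; lra).
    rewrite H. ring. }
  assert (Hsq : sqrt (l * A + B ^ 2) ^ 2 = l * A + B ^ 2)
    by (apply pow2_sqrt; nra).
  rewrite Hs in Hsq. nra.
- specialize (HD H). assert (HA' : A = l + 2 * B) by lra. subst A.
  replace (l * (l + 2 * B) + B ^ 2) with ((l + B) ^ 2) by ring.
  rewrite sqrt_pow2 by lra. field. lra.
Qed.

(** The hypothesis [A = l + 2 B] is [F = 1].  It is assumed at [t] only, and turns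
    the square root in the derivative into [B + l]. *)
Lemma is_derive_randers_scalar (A B l : R -> R) (t A' B' l' : R) :
  is_derive A t A' -> is_derive B t B' -> is_derive l t l' ->
  0 < l t -> 0 < B t + l t -> A t = l t + 2 * B t ->
  is_derive
    (fun u => (sqrt (l u * A u + B u ^ 2) / l u + - (B u / l u)) ^ 2 / 2) t
    ((A' / 2 - B' - l' / 2) / (B t + l t)).
Proof.
intros HA HB Hl Hl0 HD HAt.
assert (Hs : l t * A t + B t ^ 2 = (B t + l t) ^ 2) by (rewrite HAt; ring).
assert (Hsq : sqrt (l t * A t + B t ^ 2) = B t + l t)
  by (rewrite Hs; apply sqrt_pow2; lra).
auto_derive.
- change (B t * (B t * 1)) with (B t ^ 2). rewrite Hs.
  repeat split; try (eexists; eassumption); try lra. nra.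
- change (B t * (B t * 1)) with (B t ^ 2). rewrite Hsq.
  replace (Derive _ t) with l' by (symmetry; now apply is_derive_unique).
  replace (Derive (fun x => A x) t) with A'
    by (symmetry; now apply is_derive_unique).
  replace (Derive (fun x => B x) t) with B'
    by (symmetry; now apply is_derive_unique).
  rewrite HAt. field. lra.
Qed.

Lemma is_derive2_rotation_field (x : R -> R2) (t : R) (x' : R2) :
  is_derive2 x t x' -> is_derive2 (fun u => W (x u)) t (W x').
Proof.
intros [H1 H2]. split; unfold W, rotation_field; simpl.
- apply (is_derive_opp (fun u => mu * snd (x u)) t (mu * snd x')).
  now apply (is_derive_scal (fun u => snd (x u))).
- now apply (is_derive_scal (fun u => fst (x u))).
Qed.

(** The common source of all partial derivatives of [F^2 / 2]: [x] or [y] is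
    specialised to a coordinate line and the other one to a constant.  After
    [is_derive_randers_scalar] the numerator is half the derivative of
    [h(y - W, y - W)], by bilinearity. *)
Lemma is_derive_randers_energy (x y : R -> R2) (t : R) (x' y' : R2) :
  is_derive2 x t x' -> is_derive2 y t y' -> randers h W (x t) (y t) = 1 ->
  let v := air_velocity mu (x t) (y t) in
  is_derive (fun u => randers h W (x u) (y u) ^ 2 / 2) t
    ((metric_dx m (x t) x' v v / 2 + h (x t) v (air_velocity mu x' y'))
     / drift_factor (x t) v).
Proof.
intros Hx Hy H1 v. apply randers_unit_iff in H1.
pose proof (drift_factor_gt0 _ _ H1) as HD. fold v in HD.
unfold v in *. rewrite drift_factor_air_velocity in *.
rewrite metric_air_velocity in H1.
pose proof (is_derive2_rotation_field x t x' Hx) as HW.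
pose proof (is_derive_metric m hm _ _ _ t _ _ _ Hx Hy Hy) as HA.
pose proof (is_derive_metric m hm _ _ _ t _ _ _ Hx HW Hy) as HB.
pose proof (is_derive_Rminus _ _ t _ _ (is_derive_const 1 t)
  (is_derive_metric m hm _ _ _ t _ _ _ Hx HW HW)) as Hl.
eapply is_derive_eq.
- apply (is_derive_randers_scalar _ _ _ t _ _ _ HA HB Hl).
  + apply randers_lambda_gt0.
  + exact HD.
  + unfold h in *. lra.
- unfold Rdiv. f_equal.
  unfold zero, h, W, air_velocity, rotation_field. simpl.
  rewrite !revolution_metric_warp_defect. unfold metric_dx, dot, cross. simpl. field.
Qed.

Lemma is_derive_riemannian_energy (x y : R -> R2) (t : R) (x' y' : R2) :
  is_derive2 x t x' -> is_derive2 y t y' ->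
  is_derive (fun u => riemannian_norm h (x u) (y u) ^ 2 / 2) t
    (metric_dx m (x t) x' (y t) (y t) / 2 + h (x t) (y t) y').
Proof.
intros Hx Hy.
apply is_derive_ext with (fun u => h (x u) (y u) (y u) * / 2).
{ intros u. unfold riemannian_norm.
  now rewrite pow2_sqrt by apply revolution_metric_ge0. }
eapply is_derive_eq.
- apply (is_derive_Rmult _ _ t _ _
    (is_derive_metric m hm _ _ _ t _ _ _ Hx Hy Hy) (is_derive_const (/ 2) t)).
- unfold zero, h; simpl. rewrite !revolution_metric_warp_defect.
  unfold dot, cross. field.
Qed.

(** * The Euler-Lagrange equations in terms of momentum and force *)

Lemma is_derive2_const (p : R2) (t : R) : is_derive2 (fun _ => p) t (0, 0).
Proof.
split; [exact (is_derive_const (fst p) t) | exact (is_derive_const (snd p) t)].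
Qed.

Lemma is_derive2_line1 (b t : R) : is_derive2 (fun u => (u, b)) t e1.
Proof. split; [exact (is_derive_id t) | exact (is_derive_const b t)]. Qed.

Lemma is_derive2_line2 (a t : R) : is_derive2 (fun u => (a, u)) t e2.
Proof. split; [exact (is_derive_const a t) | exact (is_derive_id t)]. Qed.

Lemma metric_dx_0 (x v w : R2) : metric_dx m x (0, 0) v w = 0.
Proof. unfold metric_dx, dot, cross. simpl. ring. Qed.

Lemma metric_0_r (x v : R2) : revolution_metric m x v (0, 0) = 0.
Proof.
rewrite revolution_metric_warp_defect. unfold dot, cross. simpl. ring.
Qed.

Lemma air_velocity_0 (y : R2) : air_velocity mu (0, 0) y = y.
Proof. destruct y. unfold air_velocity. simpl. f_equal; ring. Qed.

Lemma euler_lagrange_congr (L : R2 -> R2 -> R) (eps : R) (c : R -> R2)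
    (q1 q2 f1 f2 : R -> R) :
  (forall s, - eps < s < eps ->
    partial_y1 L (c s) (velocity c s) = q1 s /\
    partial_y2 L (c s) (velocity c s) = q2 s /\
    partial_x1 L (c s) (velocity c s) = f1 s /\
    partial_x2 L (c s) (velocity c s) = f2 s) ->
  euler_lagrange L eps c <->
  forall t, - eps < t < eps ->
    is_derive q1 t (f1 t) /\ is_derive q2 t (f2 t).
Proof.
intros H.
apply forall_interval_iff. intros t Ht.
apply and_iff; apply (is_derive_interval_iff eps); trivial;
  try (intros s Hs); now apply H.
Qed.

Lemma euler_lagrange_riemannian (eps : R) (c : R -> R2) :
  euler_lagrange (fun x y => riemannian_norm h x y ^ 2 / 2) eps c <->
  forall t, - eps < t < eps ->
    is_derive (fun s => h (c s) (velocity c s) e1) t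
      (metric_dx m (c t) e1 (velocity c t) (velocity c t) / 2) /\
    is_derive (fun s => h (c s) (velocity c s) e2) t
      (metric_dx m (c t) e2 (velocity c t) (velocity c t) / 2).
Proof.
assert (H : forall x y : R2,
  let L := fun x y => riemannian_norm h x y ^ 2 / 2 in
  partial_y1 L x y = h x y e1 /\ partial_y2 L x y = h x y e2 /\
  partial_x1 L x y = metric_dx m x e1 y y / 2 /\
  partial_x2 L x y = metric_dx m x e2 y y / 2).
{ intros [x1 x2] [y1 y2] L.
  repeat split; apply is_derive_unique; eapply is_derive_eq.
  - apply is_derive_riemannian_energy;
      [apply is_derive2_const | apply is_derive2_line1].
  - simpl. rewrite metric_dx_0. lra.
  - apply is_derive_riemannian_energy;
      [apply is_derive2_const | apply is_derive2_line2].
  - simpl. rewrite metric_dx_0. lra.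
  - apply is_derive_riemannian_energy;
      [apply is_derive2_line1 | apply is_derive2_const].
  - simpl. unfold h. rewrite metric_0_r. lra.
  - apply is_derive_riemannian_energy;
      [apply is_derive2_line2 | apply is_derive2_const].
  - simpl. unfold h. rewrite metric_0_r. lra. }
apply (euler_lagrange_congr _ eps c (fun s => h (c s) (velocity c s) e1)
  (fun s => h (c s) (velocity c s) e2)
  (fun s => metric_dx m (c s) e1 (velocity c s) (velocity c s) / 2)
  (fun s => metric_dx m (c s) e2 (velocity c s) (velocity c s) / 2)).
intros s _. apply H.
Qed.

(** [F = 1] must hold along the whole curve because the formula for the momentum
    is used at all times near [t], not just at [t].  The terms in [mu] are
    [- h(v, dW(e_i))], with [dW(e1) = mu e2] and [dW(e2) = - mu e1]. *)
Lemma euler_lagrange_randers (eps : R) (c : R -> R2) :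
  let v s := air_velocity mu (c s) (velocity c s) in
  let D s := drift_factor (c s) (v s) in
  (forall t, - eps < t < eps -> randers h W (c t) (velocity c t) = 1) ->
  euler_lagrange (fun x y => randers h W x y ^ 2 / 2) eps c <->
  forall t, - eps < t < eps ->
    is_derive (fun s => h (c s) (v s) e1 / D s) t
      ((metric_dx m (c t) e1 (v t) (v t) / 2 - mu * h (c t) (v t) e2) / D t) /\
    is_derive (fun s => h (c s) (v s) e2 / D s) t
      ((metric_dx m (c t) e2 (v t) (v t) / 2 + mu * h (c t) (v t) e1) / D t).
Proof.
intros v D Hunit.
assert (H : forall x y : R2,
  let L := fun x y => randers h W x y ^ 2 / 2 in
  let v := air_velocity mu x y in
  randers h W x y = 1 ->
  partial_y1 L x y = h x v e1 / drift_factor x v /\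
  partial_y2 L x y = h x v e2 / drift_factor x v /\
  partial_x1 L x y = (metric_dx m x e1 v v / 2 - mu * h x v e2)
    / drift_factor x v /\
  partial_x2 L x y = (metric_dx m x e2 v v / 2 + mu * h x v e1)
    / drift_factor x v).
{ intros [x1 x2] [y1 y2] L w H1.
  repeat split; apply is_derive_unique; eapply is_derive_eq.
  - apply is_derive_randers_energy;
      [apply is_derive2_const | apply is_derive2_line1 | exact H1].
  - simpl. rewrite metric_dx_0, air_velocity_0. fold w. f_equal. lra.
  - apply is_derive_randers_energy;
      [apply is_derive2_const | apply is_derive2_line2 | exact H1].
  - simpl. rewrite metric_dx_0, air_velocity_0. fold w. f_equal. lra.
  - apply is_derive_randers_energy;
      [apply is_derive2_line1 | apply is_derive2_const | exact H1].
  - simpl. fold w. f_equal. unfold h.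
    rewrite !revolution_metric_warp_defect.
    unfold dot, cross, air_velocity, e1, e2. simpl. ring.
  - apply is_derive_randers_energy;
      [apply is_derive2_line2 | apply is_derive2_const | exact H1].
  - simpl. fold w. f_equal. unfold h.
    rewrite !revolution_metric_warp_defect.
    unfold dot, cross, air_velocity, e1, e2. simpl. ring. }
apply (euler_lagrange_congr _ eps c (fun s => h (c s) (v s) e1 / D s)
  (fun s => h (c s) (v s) e2 / D s)
  (fun s => (metric_dx m (c s) e1 (v s) (v s) / 2 - mu * h (c s) (v s) e2)
    / D s)
  (fun s => (metric_dx m (c s) e2 (v s) (v s) / 2 + mu * h (c s) (v s) e1)
    / D s)).
intros s Hs. apply H. now apply Hunit.
Qed.

End Navigation.

(** * The balance of momentum in the rotating frame *)

Lemma cos2_sin2 (a : R) : cos a * cos a + sin a * sin a = 1.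
Proof. pose proof (sin2_cos2 a). unfold Rsqr in *. lra. Qed.

(** Here [x] is a curve with momentum [p] and force [f].  The second system is the
    one satisfied by the rotated momentum divided by [D]; its [mu]-terms come from
    differentiating the rotation.  The balance hypothesis is the infinitesimal form
    of conservation of angular momentum.  The two systems are compared at the single
    time [t]. *)
Lemma rotated_momentum_balance (mu : R) (x : R -> R2) (p1 p2 D : R -> R)
    (t : R) (x' : R2) (f1 f2 : R) :
  is_derive2 x t x' ->
  (forall s, D s = 1 + mu * (fst (x s) * p2 s - snd (x s) * p1 s)) ->
  locally t (fun s => D s <> 0) ->
  fst x' * p2 t - snd x' * p1 t + (fst (x t) * f2 - snd (x t) * f1) = 0 ->
  let C := cos (mu * t) in
  let S := sin (mu * t) in
  (is_derive p1 t f1 /\ is_derive p2 t f2) <->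
  is_derive (fun s => (cos (mu * s) * p1 s - sin (mu * s) * p2 s) / D s) t
    ((C * f1 - S * f2 - mu * (S * p1 t + C * p2 t)) / D t) /\
  is_derive (fun s => (sin (mu * s) * p1 s + cos (mu * s) * p2 s) / D s) t
    ((S * f1 + C * f2 + mu * (C * p1 t - S * p2 t)) / D t).
Proof.
intros [Hx1 Hx2] HD HDne Hbal C S.
pose proof (is_derive_cos_scal mu t) as HC.
pose proof (is_derive_sin_scal mu t) as HS.
fold S in HC. fold C in HS.
assert (HD0 : D t <> 0) by (apply (locally_singleton _ _ HDne)).
split.
- intros [H1 H2].
  assert (HD' : is_derive D t 0).
  { apply is_derive_ext with
      (fun s => 1 + mu * (fst (x s) * p2 s - snd (x s) * p1 s));
      [intros s; symmetry; apply HD |].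
    eapply is_derive_eq.
    - apply is_derive_affine, is_derive_Rminus; apply is_derive_Rmult; eassumption.
    - simpl.
      transitivity (mu * (fst x' * p2 t - snd x' * p1 t
        + (fst (x t) * f2 - snd (x t) * f1))); [ring |].
      rewrite Hbal. ring. }
  split; eapply is_derive_eq.
  + apply is_derive_Rdiv; [| exact HD' | exact HD0].
    apply is_derive_Rminus; apply is_derive_Rmult; eassumption.
  + simpl. fold C S. field. exact HD0.
  + apply is_derive_Rdiv; [| exact HD' | exact HD0].
    apply is_derive_Rplus; apply is_derive_Rmult; eassumption.
  + simpl. fold C S. field. exact HD0.
- set (q1 := fun s => (cos (mu * s) * p1 s - sin (mu * s) * p2 s) / D s).
  set (q2 := fun s => (sin (mu * s) * p1 s + cos (mu * s) * p2 s) / D s).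
  intros [H1 H2].
  (* [w] is [q] rotated back, so [w = p / D].  The angular momentum of [w] is
     conserved, and through [k = 1 / D] it determines [D], which makes
     [p = w / k] differentiable although nothing is known of [D] beforehand. *)
  pose (w1 := fun s => cos (mu * s) * q1 s + sin (mu * s) * q2 s).
  pose (w2 := fun s => cos (mu * s) * q2 s - sin (mu * s) * q1 s).
  pose (k := fun s => 1 + - mu * (fst (x s) * w2 s - snd (x s) * w1 s)).
  assert (Ew1 : forall s, w1 s = p1 s / D s).
  { intros s. unfold w1, q1, q2, Rdiv.
    replace (p1 s) with
      ((cos (mu * s) * cos (mu * s) + sin (mu * s) * sin (mu * s)) * p1 s)
      at 3 by (rewrite cos2_sin2; ring).
    ring. }
  assert (Ew2 : forall s, w2 s = p2 s / D s).
  { intros s. unfold w2, q1, q2, Rdiv.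
    replace (p2 s) with
      ((cos (mu * s) * cos (mu * s) + sin (mu * s) * sin (mu * s)) * p2 s)
      at 3 by (rewrite cos2_sin2; ring).
    ring. }
  assert (Ek : forall s, D s <> 0 -> k s = / D s).
  { intros s Hs. unfold k. rewrite Ew1, Ew2.
    replace (1 + _) with ((D s - mu * (fst (x s) * p2 s - snd (x s) * p1 s))
      / D s) by (field; exact Hs).
    rewrite HD at 1. field. exact Hs. }
  assert (Hcs : C * C + S * S = 1) by apply cos2_sin2.
  assert (Eq1 : q1 t = (C * p1 t - S * p2 t) / D t) by reflexivity.
  assert (Eq2 : q2 t = (S * p1 t + C * p2 t) / D t) by reflexivity.
  assert (Hw1 : is_derive w1 t (f1 / D t)).
  { eapply is_derive_eq.
    - apply is_derive_Rplus; apply is_derive_Rmult; eassumption.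
    - simpl. fold C S. rewrite Eq1, Eq2.
      transitivity ((C * C + S * S) * f1 / D t);
        [field; exact HD0 | rewrite Hcs; field; exact HD0]. }
  assert (Hw2 : is_derive w2 t (f2 / D t)).
  { eapply is_derive_eq.
    - apply is_derive_Rminus; apply is_derive_Rmult; eassumption.
    - simpl. fold C S. rewrite Eq1, Eq2.
      transitivity ((C * C + S * S) * f2 / D t);
        [field; exact HD0 | rewrite Hcs; field; exact HD0]. }
  assert (Hk : is_derive k t 0).
  { eapply is_derive_eq.
    - apply is_derive_affine, is_derive_Rminus; apply is_derive_Rmult; eassumption.
    - simpl. rewrite Ew1, Ew2.
      transitivity (- mu * (fst x' * p2 t - snd x' * p1 t
        + (fst (x t) * f2 - snd (x t) * f1)) / D t); [field; exact HD0 |].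
      rewrite Hbal. field. exact HD0. }
  assert (Hk0 : k t <> 0).
  { rewrite Ek by exact HD0. now apply Rinv_neq_0_compat. }
  split.
  + apply is_derive_ext_loc with (fun s => w1 s / k s).
    { revert HDne. apply filter_imp. intros s Hs.
      rewrite Ek, Ew1 by exact Hs. simpl. now field. }
    eapply is_derive_eq; [apply is_derive_Rdiv; eassumption |].
    rewrite Ek by exact HD0. now field.
  + apply is_derive_ext_loc with (fun s => w2 s / k s).
    { revert HDne. apply filter_imp. intros s Hs.
      rewrite Ek, Ew2 by exact Hs. simpl. now field. }
    eapply is_derive_eq; [apply is_derive_Rdiv; eassumption |].
    rewrite Ek by exact HD0. now field.
Qed.

(** * Rotational symmetry *)

Lemma sqr_norm_rotation (mu s : R) (x : R2) :
  sqr_norm (rotation_flow mu s x) = sqr_norm x.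
Proof.
unfold sqr_norm, rotation_flow. simpl fst; simpl snd.
pose proof (cos2_sin2 (mu * s)) as H.
transitivity ((cos (mu * s) * cos (mu * s) + sin (mu * s) * sin (mu * s))
  * (fst x ^ 2 + snd x ^ 2)); [ring | rewrite H; ring].
Qed.

Lemma cross_rotation (mu s : R) (x v : R2) :
  cross (rotation_flow mu s x) (rotation_flow mu s v) = cross x v.
Proof.
unfold cross, rotation_flow. simpl fst; simpl snd.
pose proof (cos2_sin2 (mu * s)) as H.
transitivity ((cos (mu * s) * cos (mu * s) + sin (mu * s) * sin (mu * s))
  * (fst x * snd v - snd x * fst v)); [ring | rewrite H; ring].
Qed.

Lemma dot_rotation (mu s : R) (v w : R2) :
  dot (rotation_flow mu s v) (rotation_flow mu s w) = dot v w.
Proof.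
unfold dot, rotation_flow. simpl fst; simpl snd.
pose proof (cos2_sin2 (mu * s)) as H.
transitivity ((cos (mu * s) * cos (mu * s) + sin (mu * s) * sin (mu * s))
  * (fst v * fst w + snd v * snd w)); [ring | rewrite H; ring].
Qed.

Lemma metric_rotation (m : R -> R) (mu s : R) (x v w : R2) :
  revolution_metric m (rotation_flow mu s x) (rotation_flow mu s v)
    (rotation_flow mu s w) = revolution_metric m x v w.
Proof.
rewrite !revolution_metric_warp_defect.
now rewrite sqr_norm_rotation, !cross_rotation, dot_rotation.
Qed.

Lemma rotation_flow_opp (mu s : R) (x : R2) :
  rotation_flow mu s (rotation_flow (- mu) s x) = x.
Proof.
destruct x as [a b]. unfold rotation_flow. simpl.
rewrite Ropp_mult_distr_l_reverse, cos_neg, sin_neg.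
pose proof (cos2_sin2 (mu * s)) as H.
revert H. generalize (cos (mu * s)) (sin (mu * s)). intros c d H.
f_equal.
- transitivity ((c * c + d * d) * a); [ring | rewrite H; ring].
- transitivity ((c * c + d * d) * b); [ring | rewrite H; ring].
Qed.

(** Covectors rotate like vectors: [h(R v, e_i) = h(v, R^-1 e_i)]. *)
Lemma momentum_rotation (m : R -> R) (mu s : R) (x v : R2) :
  let h := revolution_metric m in
  let Rt := rotation_flow mu s in
  h (Rt x) (Rt v) e1 = cos (mu * s) * h x v e1 - sin (mu * s) * h x v e2 /\
  h (Rt x) (Rt v) e2 = sin (mu * s) * h x v e1 + cos (mu * s) * h x v e2.
Proof.
intros h Rt. unfold h, Rt.
rewrite !revolution_metric_warp_defect, sqr_norm_rotation, cross_rotation.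
unfold cross at 2 4 6 8 10 12, dot, rotation_flow, e1, e2. simpl.
split; ring.
Qed.

Lemma force_rotation (m : R -> R) (mu s : R) (x v : R2) :
  let Rt := rotation_flow mu s in
  let f e := metric_dx m x e v v in
  metric_dx m (Rt x) e1 (Rt v) (Rt v)
    = cos (mu * s) * f e1 - sin (mu * s) * f e2 /\
  metric_dx m (Rt x) e2 (Rt v) (Rt v)
    = sin (mu * s) * f e1 + cos (mu * s) * f e2.
Proof.
intros Rt f. unfold f, Rt, metric_dx.
rewrite sqr_norm_rotation, cross_rotation.
generalize (Derive (warp_defect m) (sqr_norm x)) (warp_defect m (sqr_norm x)).
intros G' G. generalize (cross x v). intros k.
unfold dot, cross, rotation_flow, e1, e2. simpl.
split; ring.
Qed.

Lemma is_derive2_rotation (mu t : R) (c : R -> R2) (c' : R2) :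
  is_derive2 c t c' ->
  is_derive2 (fun s => rotation_flow mu s (c s)) t
    (fst (rotation_flow mu t c') - mu * snd (rotation_flow mu t (c t)),
     snd (rotation_flow mu t c') + mu * fst (rotation_flow mu t (c t))).
Proof.
intros [H1 H2].
pose proof (is_derive_cos_scal mu t) as HC.
pose proof (is_derive_sin_scal mu t) as HS.
split; unfold rotation_flow; simpl; eapply is_derive_eq.
- apply is_derive_Rminus; apply is_derive_Rmult; eassumption.
- simpl. ring.
- apply is_derive_Rplus; apply is_derive_Rmult; eassumption.
- simpl. ring.
Qed.

Lemma air_velocity_rotation (mu eps t : R) (P gamma : R -> R2) :
  - eps < t < eps ->
  (forall s, - eps < s < eps -> P s = rotation_flow mu s (gamma s)) ->
  is_derive2 gamma t (velocity gamma t) ->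
  air_velocity mu (P t) (velocity P t)
  = rotation_flow mu t (velocity gamma t).
Proof.
intros Ht HP Hg.
destruct (is_derive2_rotation mu t gamma _ Hg) as [H1 H2].
assert (E : velocity P t =
  (fst (rotation_flow mu t (velocity gamma t)) - mu * snd (P t),
   snd (rotation_flow mu t (velocity gamma t)) + mu * fst (P t))).
{ rewrite (HP t Ht). unfold velocity at 1. f_equal; apply is_derive_unique.
  - revert H1. simpl fst at 3. apply is_derive_ext_loc.
    apply (locally_interval eps); trivial. intros s Hs. now rewrite HP.
  - revert H2. simpl snd at 3. apply is_derive_ext_loc.
    apply (locally_interval eps); trivial. intros s Hs. now rewrite HP. }
rewrite E. unfold air_velocity. simpl fst at 1. simpl snd at 2.
rewrite (surjective_pairing (rotation_flow mu t (velocity gamma t))) at 3.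
f_equal; simpl; ring.
Qed.

(** * Smoothness of rotated curves *)

Definition smooth_on (eps : R) (f : R -> R) : Prop :=
  forall (n : nat) (t : R), - eps < t < eps -> ex_derive_n f n t.

Lemma Derive_n_Derive (f : R -> R) (n : nat) (t : R) :
  Derive_n (Derive f) n t = Derive_n f (S n) t.
Proof.
change (Derive f) with (Derive_n f 1). rewrite Derive_n_comp.
now rewrite Nat.add_1_r.
Qed.

Lemma ex_derive_n_Derive (f : R -> R) (n : nat) (t : R) :
  ex_derive_n f (S (S n)) t <-> ex_derive_n (Derive f) (S n) t.
Proof.
split; apply ex_derive_ext; intros s; now rewrite Derive_n_Derive.
Qed.

Lemma smooth_on_Derive (eps : R) (f : R -> R) :
  smooth_on eps f -> smooth_on eps (Derive f).
Proof.
intros Hf [| n] t Ht; [exact I |].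
exact (proj1 (ex_derive_n_Derive f n t) (Hf (S (S n)) t Ht)).
Qed.

Lemma smooth_on_ext (eps : R) (f g : R -> R) :
  (forall t, - eps < t < eps -> f t = g t) ->
  smooth_on eps f -> smooth_on eps g.
Proof.
intros H Hf n t Ht. apply ex_derive_n_ext_loc with f; [| now apply Hf].
now apply (locally_interval eps).
Qed.

Lemma smooth_on_plus (eps : R) (f g : R -> R) :
  smooth_on eps f -> smooth_on eps g -> smooth_on eps (fun s => f s + g s).
Proof.
intros Hf Hg n t Ht. apply ex_derive_n_plus;
  apply (locally_interval eps); trivial; intros s Hs k _;
  [now apply Hf | now apply Hg].
Qed.

Lemma smooth_on_mult (eps : R) (f g : R -> R) :
  smooth_on eps f -> smooth_on eps g -> smooth_on eps (fun s => f s * g s).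
Proof.
intros Hf Hg n.
enough (H : forall k f g, (k <= n)%nat -> smooth_on eps f -> smooth_on eps g ->
  forall t, - eps < t < eps -> ex_derive_n (fun s => f s * g s) k t)
  by now apply H.
clear f g Hf Hg. induction n as [| n IH]; intros [| k] f g Hk Hf Hg t Ht;
  try exact I; [inversion Hk |].
assert (HD : forall s, - eps < s < eps ->
  is_derive (fun u => f u * g u) s (Derive f s * g s + f s * Derive g s)).
{ intros s Hs. apply is_derive_Rmult; apply Derive_correct;
    [exact (Hf 1%nat s Hs) | exact (Hg 1%nat s Hs)]. }
destruct k as [| k]; [eexists; now apply HD |].
apply (proj2 (ex_derive_n_Derive _ _ _)).
apply ex_derive_n_ext_loc with (fun s => Derive f s * g s + f s * Derive g s).
{ apply (locally_interval eps); trivial. intros s Hs. symmetry.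
  now apply is_derive_unique, HD. }
apply le_S_n in Hk.
apply ex_derive_n_plus; apply (locally_interval eps); trivial;
  intros s Hs j Hj; apply IH; trivial;
  try (now apply smooth_on_Derive); now apply Nat.le_trans with (S k).
Qed.

(** The general combination of cosine and sine is what the induction on the order
    of the derivative needs. *)
Lemma smooth_on_trig (eps mu a b : R) :
  smooth_on eps (fun s => a * cos (mu * s) + b * sin (mu * s)).
Proof.
intros n t _. destruct n as [| n]; [exact I |].
assert (H : exists a' b', forall s,
  Derive_n (fun s => a * cos (mu * s) + b * sin (mu * s)) n s
  = a' * cos (mu * s) + b' * sin (mu * s)).
{ induction n as [| n [a' [b' IH]]]; [now exists a, b |].
  exists (mu * b'), (- mu * a'). intros s. simpl.
  rewrite (Derive_ext _ _ s IH). apply is_derive_unique.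
  auto_derive; trivial. ring. }
destruct H as [a' [b' H]].
apply ex_derive_ext with (fun s => a' * cos (mu * s) + b' * sin (mu * s)).
- intros s. now rewrite H.
- auto_derive. trivial.
Qed.

Lemma smooth_curve_rotation (eps mu : R) (c d : R -> R2) :
  (forall s, - eps < s < eps -> d s = rotation_flow mu s (c s)) ->
  smooth_curve eps c -> smooth_curve eps d.
Proof.
intros Hd Hc.
assert (H1 : smooth_on eps (fun s => fst (c s))) by (intros n t Ht; now apply Hc).
assert (H2 : smooth_on eps (fun s => snd (c s))) by (intros n t Ht; now apply Hc).
intros n t Ht. split; revert n t Ht.
- apply (smooth_on_ext eps (fun s =>
    (1 * cos (mu * s) + 0 * sin (mu * s)) * fst (c s)
    + (0 * cos (mu * s) + (-1) * sin (mu * s)) * snd (c s))).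
  + intros t Ht. rewrite Hd by exact Ht. unfold rotation_flow. simpl. ring.
  + apply smooth_on_plus; apply smooth_on_mult; trivial; apply smooth_on_trig.
- apply (smooth_on_ext eps (fun s =>
    (0 * cos (mu * s) + 1 * sin (mu * s)) * fst (c s)
    + (1 * cos (mu * s) + 0 * sin (mu * s)) * snd (c s))).
  + intros t Ht. rewrite Hd by exact Ht. unfold rotation_flow. simpl. ring.
  + apply smooth_on_plus; apply smooth_on_mult; trivial; apply smooth_on_trig.
Qed.

(** * The correspondence of geodesics *)

Lemma riemannian_unit_iff (m : R -> R) (x y : R2) :
  riemannian_norm (revolution_metric m) x y = 1 <->
  revolution_metric m x y y = 1.
Proof.
unfold riemannian_norm. pose proof (revolution_metric_ge0 m x y) as H0. split.
- intros H. rewrite <- (pow2_sqrt _ H0), H. ring.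
- intros ->. apply sqrt_1.
Qed.

(** The infinitesimal form of [metric_rotation]: [gamma' x p + gamma x f = 0]. *)
Lemma clairaut_balance (m : R -> R) (x v : R2) :
  let h := revolution_metric m in
  fst v * h x v e2 - snd v * h x v e1
  + (fst x * (metric_dx m x e2 v v / 2) - snd x * (metric_dx m x e1 v v / 2))
  = 0.
Proof.
intros h. unfold h. rewrite !revolution_metric_warp_defect.
unfold metric_dx, dot, cross, e1, e2. simpl. field.
Qed.

Lemma drift_factor_momentum (m : R -> R) (mu : R) (x v : R2) :
  drift_factor m mu x v
  = 1 + mu * (fst x * revolution_metric m x v e2
              - snd x * revolution_metric m x v e1).
Proof.
unfold drift_factor. rewrite !revolution_metric_warp_defect.
unfold dot, cross, rotation_field, e1, e2. simpl. ring.
Qed.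

Lemma drift_factor_rotation (m : R -> R) (mu s : R) (x v : R2) :
  drift_factor m mu (rotation_flow mu s x) (rotation_flow mu s v)
  = drift_factor m mu x v.
Proof.
unfold drift_factor.
replace (rotation_field mu (rotation_flow mu s x))
  with (rotation_flow mu s (rotation_field mu x)); [now rewrite metric_rotation |].
unfold rotation_field, rotation_flow. simpl. f_equal; ring.
Qed.

(** The momentum and force of [P] are those of [gamma], rotated; so the equations
    of [P] are the second system of [rotated_momentum_balance] for [gamma]. *)
Lemma unit_speed_geodesic_rotation (m : R -> R) (mu : R)
    (hm : warp_function m) (hmu : 0 < mu)
    (hbound : forall r : R, 0 <= r -> m r < 1 / mu)
    (eps : R) (P gamma : R -> R2) :
  smooth_curve eps P -> smooth_curve eps gamma ->
  (forall s, - eps < s < eps -> P s = rotation_flow mu s (gamma s)) ->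
  unit_speed_geodesic (randers (revolution_metric m) (rotation_field mu)) eps P
  <-> unit_speed_geodesic (riemannian_norm (revolution_metric m)) eps gamma.
Proof.
intros HsP Hsg HP.
set (h := revolution_metric m).
assert (Hg : forall t, - eps < t < eps ->
  is_derive2 gamma t (velocity gamma t)).
{ intros t Ht. destruct (Hsg 1%nat t Ht) as [H1 H2].
  split; now apply Derive_correct. }
assert (Hv : forall t, - eps < t < eps ->
  air_velocity mu (P t) (velocity P t) = rotation_flow mu t (velocity gamma t)).
{ intros t Ht. apply (air_velocity_rotation mu eps); trivial. now apply Hg. }
assert (Hunit : forall t, - eps < t < eps ->
  randers h (rotation_field mu) (P t) (velocity P t) = 1 <->
  riemannian_norm h (gamma t) (velocity gamma t) = 1).
{ intros t Ht. unfold h.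
  rewrite (randers_unit_iff m mu hm hmu hbound), riemannian_unit_iff.
  rewrite Hv, HP by exact Ht. now rewrite metric_rotation. }
assert (HEL : (forall t, - eps < t < eps ->
    riemannian_norm h (gamma t) (velocity gamma t) = 1) ->
  euler_lagrange (fun x y => randers h (rotation_field mu) x y ^ 2 / 2) eps P
  <-> euler_lagrange (fun x y => riemannian_norm h x y ^ 2 / 2) eps gamma).
{ intros H1. unfold h in *.
  rewrite (euler_lagrange_riemannian m hm).
  rewrite (euler_lagrange_randers m mu hm hmu hbound)
    by (intros t Ht; now apply Hunit, H1).
  pose (D := fun s => drift_factor m mu (gamma s) (velocity gamma s)).
  pose (p1 := fun s => revolution_metric m (gamma s) (velocity gamma s) e1).
  pose (p2 := fun s => revolution_metric m (gamma s) (velocity gamma s) e2).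
  assert (HD : forall s, - eps < s < eps -> D s <> 0).
  { intros s Hs. apply Rgt_not_eq, (drift_factor_gt0 m mu hm hmu hbound).
    now apply riemannian_unit_iff, H1. }
  assert (Hbal : forall t, - eps < t < eps -> _) by
    (intros t Ht; exact (rotated_momentum_balance mu gamma p1 p2 D t _ _ _
      (Hg t Ht) (fun s => drift_factor_momentum m mu _ _)
      (locally_interval eps t _ Ht HD)
      (clairaut_balance m (gamma t) (velocity gamma t)))).
  cbv beta zeta in Hbal.
  assert (Hq1 : forall s, - eps < s < eps -> 
    revolution_metric m (P s) (air_velocity mu (P s) (velocity P s)) e1
    = cos (mu * s) * p1 s - sin (mu * s) * p2 s).
  { intros s Hs. rewrite Hv, HP by exact Hs. apply momentum_rotation. }
  assert (Hq2 : forall s, - eps < s < eps -> 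
    revolution_metric m (P s) (air_velocity mu (P s) (velocity P s)) e2
    = sin (mu * s) * p1 s + cos (mu * s) * p2 s).
  { intros s Hs. rewrite Hv, HP by exact Hs. apply momentum_rotation. }
  assert (HDP : forall s, - eps < s < eps -> 
    drift_factor m mu (P s) (air_velocity mu (P s) (velocity P s)) = D s).
  { intros s Hs. rewrite Hv, HP by exact Hs. apply drift_factor_rotation. }
  apply forall_interval_iff. intros t Ht.
  apply iff_sym. eapply iff_trans; [exact (Hbal t Ht) | apply iff_sym].
  destruct (force_rotation m mu t (gamma t) (velocity gamma t)) as [F1 F2].
  apply and_iff; apply (is_derive_interval_iff eps); trivial.
  - intros s Hs. now rewrite Hq1, HDP.
  - rewrite Hq2, HDP by exact Ht. rewrite Hv, HP by exact Ht. rewrite F1.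
    f_equal. field.
  - intros s Hs. now rewrite Hq2, HDP.
  - rewrite Hq1, HDP by exact Ht. rewrite Hv, HP by exact Ht. rewrite F2.
    f_equal. field. }
unfold unit_speed_geodesic, geodesic.
split; intros [[_ HE] H1].
- assert (H1' : forall t, - eps < t < eps ->
    riemannian_norm h (gamma t) (velocity gamma t) = 1)
    by (intros t Ht; now apply Hunit, H1).
  split; [split |]; trivial. now apply HEL.
- split; [split |]; trivial; [now apply HEL |].
  intros t Ht. now apply Hunit, H1.
Qed.

Theorem theorem1p1 (m : R -> R) (mu : R) (hm : warp_function m) (hmu : 0 < mu)
    (hbound : forall r : R, 0 <= r -> m r < 1 / mu)
    (eps : R) (heps : 0 < eps) (P : R -> R2) :
  unit_speed_geodesic
    (randers (revolution_metric m) (rotation_field mu)) eps P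
  <->
  exists gamma : R -> R2,
    unit_speed_geodesic (riemannian_norm (revolution_metric m)) eps gamma /\
    forall s : R, - eps < s < eps -> P s = rotation_flow mu s (gamma s).
Proof.
split.
- intros HP. pose (gamma := fun s => rotation_flow (- mu) s (P s)).
  assert (E : forall s, P s = rotation_flow mu s (gamma s))
    by (intros s; symmetry; apply rotation_flow_opp).
  assert (HsP : smooth_curve eps P) by apply HP.
  exists gamma. split; [| intros s _; apply E].
  apply (unit_speed_geodesic_rotation m mu hm hmu hbound eps P gamma);
    trivial.
  now apply (smooth_curve_rotation eps (- mu) P).
- intros [gamma [Hg E]].
  assert (Hsg : smooth_curve eps gamma) by apply Hg.
  apply (unit_speed_geodesic_rotation m mu hm hmu hbound eps P gamma);
    trivial.
  now apply (smooth_curve_rotation eps mu gamma).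
Qed.
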